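(* Let $\Gamma$ be a finite connected quiver, and let $(T,f)$ be a top-representation of $\Gamma$ such that every $T(i)$ is connected. Then $At^\Gamma(T,f)$ is connected.
   Context: A quiver $\Gamma=(\Gamma_0,\Gamma_1)$ is an oriented graph with vertex set $\Gamma_0$ and arrow set $\Gamma_1$; it is finite if $\Gamma_0$ and $\Gamma_1$ are finite, and connected if its underlying unoriented graph is connected. A top-representation $(T,f)$ of $\Gamma$ is a family of topological spaces $T(i)$, $i\in\Gamma_0$, with a continuous map $f_a:T(i)\to T(j)$ for each arrow $a:i\to j$. $At^\Gamma(T,f)$ is the quotient space of $\coprod_{i\in\Gamma_0}T(i)$ by the equivalence relation generated by $D=\{(x_i,x_j): x_i\in T(i),\ x_j\in T(j),\ f_a(x_i)=x_j\text{ for some arrow }a:i\to j\}$. *)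

(* Defs.v *)
From HB Require Import structures.
From Stdlib Require Import Relations.
From mathcomp Require Import all_boot all_order all_algebra.
From mathcomp Require Import all_classical all_reals all_analysis.

Set Implicit Arguments.
Unset Strict Implicit.
Unset Printing Implicit Defensive.

Local Open Scope classical_set_scope.

(* Loops and parallel arrows are allowed. The choice structure on the vertices
   is what the library's disjoint-union topology on {i & T i} asks for;
   classically every type carries one. *)
Record quiver := Quiver {
  vertex : choiceType;
  arrow : Type;
  src : arrow -> vertex;
  tgt : arrow -> vertex }.

Definition finite_quiver (G : quiver) : Prop :=
  finite_set [set: vertex G] /\ finite_set [set: arrow G].

Definition unoriented_adj (G : quiver) : relation (vertex G) := fun i j =>
  exists a : arrow G, (src a = i /\ tgt a = j) \/ (src a = j /\ tgt a = i).

(* As for spaces below, a connected graph is nonempty. *)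
Definition connected_quiver (G : quiver) : Prop :=
  [set: vertex G] !=set0 /\
  forall i j : vertex G, clos_refl_trans (vertex G) (@unoriented_adj G) i j.

Record top_rep (G : quiver) := TopRep {
  rep_space : vertex G -> topologicalType;
  rep_map : forall a : arrow G, rep_space (src a) -> rep_space (tgt a);
  rep_map_continuous : forall a : arrow G, continuous (rep_map (a := a)) }.

(* Connected spaces are nonempty, whereas the library's [connected] holds of
   the empty set. Nonemptiness is needed: for the quiver 1 <- 0 -> 2, gluing
   two points along an empty T(0) gives a two-point discrete space. *)
Definition connected_space (X : topologicalType) : Prop :=
  [set: X] !=set0 /\ connected [set: X].

Section Atlas.
Context (G : quiver) (T : top_rep G).

Let total := {i : vertex G & rep_space T i}.

Definition arrow_rel : relation total := fun x y =>
  exists (a : arrow G) (z : rep_space T (src a)),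
    x = existT (rep_space T) (src a) z /\
    y = existT (rep_space T) (tgt a) (rep_map z).

Definition glue_rel : rel total :=
  fun x y => `[< clos_refl_sym_trans total arrow_rel x y >].

Lemma glue_rel_refl : reflexive glue_rel.
Proof. by move=> x; apply/asboolP; exact: rst_refl. Qed.

Lemma glue_rel_sym : symmetric glue_rel.
Proof. by move=> x y; apply/asboolP/asboolP; exact: rst_sym. Qed.

Lemma glue_rel_trans : transitive glue_rel.
Proof.
move=> y x z /asboolP xy /asboolP yz; apply/asboolP.
exact: rst_trans xy yz.
Qed.

Definition glue_equiv : equiv_rel total :=
  EquivRel glue_rel glue_rel_refl glue_rel_sym glue_rel_trans.

Definition At : topologicalType :=
  quotient_topology {eq_quot glue_equiv}%qT.

End Atlas.

(* Main.v *)
Require Import Defs.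
From Stdlib Require Import Relations.
From mathcomp Require Import all_boot all_order all_algebra.
From mathcomp Require Import all_classical all_reals all_analysis.

(** Each [T i] maps continuously into the glued space, so its image there is
    connected and lies in a single connected component. An arrow [i -> j]
    identifies any point of [T i] with a point of [T j]; since [T i] is
    nonempty there is such a point, so the images of [T i] and [T j] meet and
    lie in the same component. Following an unoriented path in the quiver, the
    images of any two vertices lie in the same component. These images cover
    the glued space, which therefore has only one component. *)

Local Open Scope classical_set_scope.

Section Gluing.
Context {G : quiver} (T : top_rep G).

Definition chart (i : vertex G) (x : rep_space T i) : At T :=
  (\pi_(quotient_topology {eq_quot (glue_equiv T)}%qT)
     (existT (rep_space T) i x))%qT.

Lemma chart_continuous (i : vertex G) : continuous (chart i).
Proof.
move=> x; apply: continuous_comp; first exact: existT_continuous.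
exact: pi_continuous.
Qed.

Lemma chart_surj (p : At T) : exists (i : vertex G) (x : rep_space T i),
  p = chart i x.
Proof.
exists (tag (repr p)), (tagged (repr p)).
by rewrite /chart -[LHS]reprK; case: (repr p).
Qed.

Lemma chart_arrow (a : arrow G) (z : rep_space T (src a)) :
  chart (src a) z = chart (tgt a) (rep_map z).
Proof.
apply/eqmodP/asboolP; apply: rst_step.
by exists a, z.
Qed.

(** A relation between vertices rather than between points, so that it can be
    propagated along paths of the quiver. *)
Definition same_component (i j : vertex G) : Prop :=
  forall (x : rep_space T i) (y : rep_space T j),
    connected_component [set: At T] (chart i x) (chart j y).

Lemma same_component_sym (i j : vertex G) :
  same_component i j -> same_component j i.
Proof. by move=> ij x y; exact/connected_component_sym. Qed.

(** A point of the middle space is needed to link the two outer ones. *)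
Lemma same_component_trans (i j k : vertex G) :
  [set: rep_space T j] !=set0 ->
  same_component i j -> same_component j k -> same_component i k.
Proof.
move=> [y _] ij jk x z.
by apply: connected_component_trans (ij x y) _; exact: jk.
Qed.

Lemma same_component_refl (i : vertex G) :
  connected [set: rep_space T i] -> same_component i i.
Proof.
move=> Ti x y; exists (chart i @` setT); last by exists y.
split=> //.
apply: connected_continuous_connected => //.
apply: continuous_subspaceT; exact: chart_continuous.
Qed.

Lemma same_component_arrow (a : arrow G) :
  connected_space (rep_space T (src a)) ->
  connected [set: rep_space T (tgt a)] ->
  same_component (src a) (tgt a).
Proof.
move=> [[z _] Tsrc] Ttgt x y.
apply: (@connected_component_trans _ _ (chart (src a) z)).
  exact: same_component_refl.
by rewrite chart_arrow; exact: same_component_refl.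
Qed.

Lemma same_component_path (i j : vertex G) :
  (forall k, connected_space (rep_space T k)) ->
  clos_refl_trans (vertex G) (@unoriented_adj G) i j -> same_component i j.
Proof.
move=> Tconn; elim=> [{}i {}j [a [[<- <-]|[<- <-]]]|{}i|{}i k {}j _ ik _ kj].
- by apply: same_component_arrow => //; exact: (Tconn _).2.
- apply: same_component_sym.
  by apply: same_component_arrow => //; exact: (Tconn _).2.
- exact/same_component_refl/(Tconn i).2.
- exact: same_component_trans (Tconn k).1 ik kj.
Qed.

End Gluing.

Theorem theorem6p5 (G : quiver) (T : top_rep G) :
  finite_quiver G -> connected_quiver G ->
  (forall i : vertex G, connected_space (rep_space T i)) ->
  connected_space (At T).
Proof.
move=> _ [[i _] Gconn] Tconn; have [x _] := (Tconn i).1.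
split; first by exists (chart T i x).
suff <- : connected_component [set: At T] (chart T i x) = [set: At T].
  exact: component_connected.
apply/seteqP; split=> // p _; have [j [y ->]] := chart_surj T p.
exact: same_component_path.
Qed.
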